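(* Let $G$ be a finite group, $N\unlhd G$, $J=J(F[N])$ and $I=\{\alpha\in F[G]\mid J\alpha=0\}$. Let $N_p$ denote the set of all $p$-elements of $N$ and let $c=\sum_{x\in N_p}x\in F[G]$. Then $$I=F[G]c^{2}\;\oplus\;\Big(\bigoplus_{e_B\notin I}Ie_B\Big),$$ where the second sum runs over the $p$-blocks $B$ of $F[G]$ whose block idempotent $e_B$ does not lie in $I$. In particular, $I\subseteq J(F[G])$ if and only if $c^{2}=0$.
   Context: $F$ is a field of characteristic $p>0$ that is a splitting field for the groups considered. $J(R)$ denotes the Jacobson radical of a ring $R$. A $p$-element is an element whose order is a power of $p$ (the identity included). $e_B$ denotes the block idempotent (the primitive central idempotent of $F[G]$) of a block $B$ of $F[G]$. *)

(* Defs.v *)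
From HB Require Import structures.
From mathcomp Require Import all_boot all_order all_algebra all_fingroup.
From mathcomp Require Import all_solvable all_field all_character.
From mathcomp Require Import boolp classical_sets.

Set Implicit Arguments.
Unset Strict Implicit.
Unset Printing Implicit Defensive.

Import GroupScope GRing.Theory.
Local Open Scope ring_scope.

(* F[G], for G the whole of a finGroupType: an element is its family of
   coefficients. The base is [F^o], not [F], to
   get the vector space structure; only that structure is copied, so that the
   product below is convolution and not the pointwise product. *)
Definition galg (F : fieldType) (gT : finGroupType) := {ffun gT -> F^o}.

Section GroupAlgebra.

Variables (F : fieldType) (gT : finGroupType).
Local Notation A := (galg F gT).

HB.instance Definition _ := Vector.copy A {ffun gT -> F^o}.

Definition gdelta (x : gT) : A := [ffun y => (y == x)%:R].

Definition galg_mul (a b : A) : A :=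
  [ffun x => \sum_(y : gT) (a y : F) * b (y^-1 * x)%g].

Lemma galg_mulA : associative galg_mul.
Proof.
move=> a b c; apply/ffunP => x; rewrite !ffunE.
under eq_bigr => y _ do rewrite ffunE mulr_sumr.
under [RHS]eq_bigr => z _ do rewrite ffunE mulr_suml.
rewrite [RHS]exchange_big /=; apply: eq_bigr => y _.
rewrite [RHS](reindex_inj (mulgI y)) /=; apply: eq_bigr => z _.
by rewrite mulrA invMg mulKg mulgA.
Qed.

Lemma galg_mul1l : left_id (gdelta 1) galg_mul.
Proof.
move=> a; apply/ffunP => x; rewrite ffunE (bigD1 1%g) //= big1 => [|y ny].
  by rewrite addr0 ffunE eqxx mul1r invg1 mul1g.
by rewrite ffunE (negPf ny) mul0r.
Qed.

Lemma galg_mul1r : right_id (gdelta 1) galg_mul.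
Proof.
move=> a; apply/ffunP => x; rewrite ffunE (bigD1 x) //= big1 => [|y ny].
  by rewrite addr0 ffunE mulVg eqxx mulr1.
by rewrite ffunE -eq_mulVg1 (negPf ny) mulr0.
Qed.

Lemma galg_mulDl : left_distributive galg_mul +%R.
Proof.
move=> a b c; apply/ffunP => x; rewrite !ffunE -big_split.
by apply: eq_bigr => y _; rewrite ffunE mulrDl.
Qed.

Lemma galg_mulDr : right_distributive galg_mul +%R.
Proof.
move=> a b c; apply/ffunP => x; rewrite !ffunE -big_split.
by apply: eq_bigr => y _; rewrite ffunE mulrDr.
Qed.

Lemma galg_oner_neq0 : gdelta 1 != 0 :> A.
Proof.
by apply/eqP => /ffunP/(_ 1%g)/eqP; rewrite !ffunE eqxx oner_eq0.
Qed.

HB.instance Definition _ := GRing.Zmodule_isNzRing.Build A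
  galg_mulA galg_mul1l galg_mul1r galg_mulDl galg_mulDr galg_oner_neq0.

Lemma galg_scaleAl (k : F) (a b : A) : k *: (a * b) = (k *: a) * b.
Proof.
apply/ffunP => x; rewrite !ffunE scaler_sumr.
by apply: eq_bigr => y _; rewrite ffunE /GRing.scale /= mulrA.
Qed.

HB.instance Definition _ :=
  GRing.Lmodule_isLalgebra.Build F A galg_scaleAl.

Lemma galg_scaleAr (k : F) (a b : A) : k *: (a * b) = a * (k *: b).
Proof.
apply/ffunP => x; rewrite !ffunE scaler_sumr.
by apply: eq_bigr => y _; rewrite ffunE /GRing.scale /= mulrCA.
Qed.

HB.instance Definition _ := GRing.Lalgebra_isAlgebra.Build F A galg_scaleAr.
HB.instance Definition _ := Algebra_isFalgebra.Build F A.

End GroupAlgebra.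

Arguments gdelta F {gT} x.

Definition galg_incl (F : fieldType) (gT : finGroupType) (N : {group gT})
    (a : galg F (subg_of N)) : galg F gT :=
  \sum_(x : subg_of N) (a x : F) *: gdelta F (sgval x).

(* [idealr_closed] is the library's notion of proper left ideal. *)
Definition maximal_left_ideal (R : nzRingType) (M : {pred R}) : Prop :=
  idealr_closed M /\
  forall M' : {pred R}, idealr_closed M' ->
    {subset M <= M'} -> {subset M' <= M}.

Definition jacobson (R : nzRingType) : set R :=
  [set x | forall M : {pred R}, maximal_left_ideal M -> x \in M]%classic.
Arguments jacobson : clear implicits.

Lemma ex_vspace (F : fieldType) (V : vectType F) (S : set V) :
    S 0 -> (forall k u v, S u -> S v -> S (k *: u + v)) ->
  exists U : {vspace V}, forall x, x \in U <-> S x.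
Proof.
move=> S0 Slin.
have: forall n (U : {vspace V}), (\dim {:V} - \dim U < n)%N ->
    (forall x, x \in U -> S x) -> exists W : {vspace V}, forall x, x \in W <-> S x.
  elim=> // n IHn U leUn sUS.
  have [/existsNP[x /not_implyP[Sx /negP xU]]|SU] :=
    pselect (~ forall x, S x -> x \in U); last first.
    by exists U => x; split=> [/sUS //|]; move: x; apply: contrapT.
  apply: (IHn (U + <[x]>)%VS) => [|y /memv_addP[u uU [_ /vlineP[k ->] ->]]].
    have ltUx: (\dim U < \dim (U + <[x]>))%N.
      rewrite (ltn_leqif (dimv_leqif_sup (addvSl _ _))).
      by apply: contra xU => /subvP; apply; rewrite (subvP (addvSr _ _)) ?memv_line.
    rewrite -ltnS; apply: leq_trans leUn; rewrite ltnS.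
    by apply: ltn_sub2l => //; apply: leq_trans ltUx (dimvS (subvf _)).
  by rewrite addrC; apply: Slin => //; apply: sUS.
by move=> /(_ _ 0%VS (ltnSn _)); apply=> x; rewrite memv0 => /eqP->.
Qed.

Section FinDimAlgebra.

Variables (F : fieldType) (A : falgType F).

Lemma ex_right_annihilator (S : set A) :
  exists U : {vspace A}, forall a, a \in U <-> forall j, S j -> j * a = 0.
Proof.
apply: ex_vspace => [j _|k u v annu annv j Sj]; first exact: mulr0.
by rewrite mulrDr -scalerAr annu ?annv // scaler0 addr0.
Qed.

Definition right_annihilator (S : set A) : {vspace A} :=
  projT1 (cid (ex_right_annihilator S)).

Lemma right_annihilatorP (S : set A) (a : A) :
  a \in right_annihilator S <-> forall j, S j -> j * a = 0.
Proof. exact: (projT2 (cid (ex_right_annihilator S))). Qed.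

Definition central_idempotent (e : A) : Prop :=
  e \in 'Z({:A})%VS /\ e * e = e.

Definition block_idempotent (e : A) : Prop :=
  [/\ central_idempotent e, e != 0 &
      forall e1 e2 : A, central_idempotent e1 -> central_idempotent e2 ->
        e1 * e2 = 0 -> e = e1 + e2 -> e1 = 0 \/ e2 = 0].

Lemma block_idempotent_orth (e f : A) :
  block_idempotent e -> block_idempotent f -> e != f -> e * f = 0.
Proof.
have cenP (x y : A) : x \in 'Z({:A})%VS -> x * y = y * x.
  by rewrite memv_cap => /andP[_ /centvP->]; rewrite ?memvf.
have half (x y : A) : block_idempotent x -> block_idempotent y ->
    x * y = 0 \/ x * y = x.
  case=> [[Zx xx] _ primx] [[Zy yy] _ _].
  have Zxy: x * y \in 'Z({:A})%VS by apply: memvM.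
  have xyxy: x * y * (x * y) = x * y.
    by rewrite -mulrA (mulrA y) (cenP y x Zy) !mulrA xx -mulrA yy.
  have xxy: x * (x * y) = x * y by rewrite mulrA xx.
  have xyx: x * y * x = x * y by rewrite cenP.
  have [] := primx (x * y) (x - x * y).
  - by split.
  - split; first exact: memvB.
    by rewrite mulrBl !mulrBr xx xxy xyx xyxy subrr subr0.
  - by rewrite mulrBr xyx xyxy subrr.
  - by rewrite addrC subrK.
  - by left.
  - by move/eqP; rewrite subr_eq0 => /eqP <-; right.
move=> Be Bf nef; have [//|efe] := half e f Be Bf.
have cef: e * f = f * e by case: Be => [[Ze _] _ _]; apply: cenP.
have [fe0|fef] := half f e Bf Be; first by rewrite cef.
by rewrite -efe cef fef eqxx in nef.
Qed.

Lemma block_idempotents_free (s : seq A) :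
  uniq s -> (forall e, e \in s -> block_idempotent e) -> free s.
Proof.
elim: s => [_ _|e s IHs /= /andP[es us] Bs]; first exact: nil_free.
rewrite free_cons IHs // => [|f fs]; last by apply: Bs; rewrite inE fs orbT.
rewrite andbT; apply/negP => span_e.
have Be := Bs e (mem_head _ _); case: (Be) => -[_ ee] /eqP e0 _; apply: e0.
rewrite -ee {2}(coord_span (X := in_tuple s) span_e) mulr_sumr big1 // => i _.
rewrite -scalerAr block_idempotent_orth ?scaler0 //.
  by apply: Bs; rewrite inE mem_nth ?orbT.
by apply: contra es => /eqP->; rewrite mem_nth.
Qed.

Lemma ex_block_idempotents :
  exists s : seq A, uniq s /\ (forall e, e \in s <-> block_idempotent e).
Proof.
have: forall n (s : seq A), (\dim {:A} - size s < n)%N -> uniq s ->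
    (forall e, e \in s -> block_idempotent e) ->
    exists s : seq A, uniq s /\ (forall e, e \in s <-> block_idempotent e).
  elim=> // n IHn s les us Bs.
  have [/existsNP[e /not_implyP[Be /negP es]]|sB] :=
    pselect (~ forall e, block_idempotent e -> e \in s); last first.
    exists s; split=> // e; split=> [/Bs //|]; move: e.
    exact: contrapT.
  have ues: uniq (e :: s) by rewrite /= es.
  have Bes f : f \in e :: s -> block_idempotent f.
    by rewrite inE => /predU1P[-> //|/Bs].
  apply: (IHn (e :: s)) => //; rewrite -ltnS; apply: leq_trans les.
  rewrite ltnS; apply: ltn_sub2l => //.
  have := block_idempotents_free ues Bes.
  by rewrite /free => /eqP dims; have := dimvS (subvf <<e :: s>>%VS); rewrite dims.
by move=> /(_ _ [::] (ltnSn _)); apply.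
Qed.

Definition block_idempotents : seq A := projT1 (cid ex_block_idempotents).

Lemma block_idempotents_uniq : uniq block_idempotents.
Proof. by case: (projT2 (cid ex_block_idempotents)). Qed.

Lemma block_idempotentsP (e : A) :
  e \in block_idempotents <-> block_idempotent e.
Proof. by case: (projT2 (cid ex_block_idempotents)) => _; apply. Qed.

End FinDimAlgebra.

Arguments block_idempotents {F} A.

(* Main.v *)
Require Import Defs.
From HB Require Import structures.
From mathcomp Require Import all_boot all_order all_algebra all_fingroup.
From mathcomp Require Import all_solvable all_field all_character.
From mathcomp Require Import boolp classical_sets.

Set Implicit Arguments.
Unset Strict Implicit.
Unset Printing Implicit Defensive.

Import GroupScope GRing.Theory.
Local Open Scope ring_scope.

(* Write A = F[N], J = J(A), lambda(a) = the sum of the coefficients of a at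
   p-elements, so that lambda(a) is the coefficient at 1 of a c. Rotating words
   of length q = p^k shows that (a^q)(1) = lambda(a)^q for large k. On nilpotent
   elements this gives lambda = 0, hence J c = 0; on an idempotent e it gives
   lambda(e) = e(1). If moreover A e is a minimal left ideal, splitting gives
   e A e = F e, so e(1) <> 0 (otherwise (A e)(1) = 0), e c is a multiple of e,
   and comparing coefficients at 1 yields e c = e. A left ideal annihilated by J
   and not contained in J contains such an e. Applied to A (c^3 - c^2) this shows
   that c^2 is a central idempotent, and applied to A b that J b = 0 and
   c^2 b = 0 force b in J. Going up to F[G] coset by coset,
   I (1 - c^2) has square zero, because I is a two-sided ideal. So a block
   idempotent e lies in I iff e c^2 = e, and otherwise e c^2 = 0. *)

(** * Radical, idempotents and blocks of a finite-dimensional algebra *)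

Section FinDimRadical.

Variables (F : fieldType) (A : falgType F).
Implicit Types (a b c e x y : A) (K : {vspace A}).

Definition nilpotent_elt a : Prop := exists n, a ^+ n = 0.

Lemma nilpotent_eltC a b : nilpotent_elt (a * b) -> nilpotent_elt (b * a).
Proof.
case=> n abn; exists n.+1.
suff ->: (b * a) ^+ n.+1 = b * (a * b) ^+ n * a by rewrite abn mulr0 mul0r.
elim: n {abn} => [|n IHn]; first by rewrite expr1 expr0 mulr1.
by rewrite exprSr IHn (exprSr (a * b)) !mulrA.
Qed.

(** The left ideal generated by [a] is nil; [jacobsonP] shows that this characterises the Jacobson
    radical. *)
Definition left_nil a : Prop := forall x, nilpotent_elt (x * a).

Lemma left_nilM a x y :
  left_nil a -> left_nil (x * a * y).
Proof.
by move=> nila z; rewrite mulrA; apply: nilpotent_eltC; rewrite !mulrA.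
Qed.

Lemma nilpotent_sub1_inv b : nilpotent_elt b -> exists u, u * (1 - b) = 1.
Proof.
case=> n bn; exists (\sum_(i < n) b ^+ i).
suff -> : (\sum_(i < n) b ^+ i) * (1 - b) = (1 - b) * \sum_(i < n) b ^+ i.
  by rewrite -opprB mulNr -subrX1 bn sub0r opprK.
apply/esym/commr_sum => i _.
by apply/commrX/commr_sym/commrB; [apply: commr1|].
Qed.

(** Fitting's lemma by polynomials. Some nonzero P = X^k Q with Q(0) <> 0 kills [b]; inverting Q
    modulo X^k gives [w], a polynomial in [b], with b^k = b^k (w b). Then (w b)^(k+1) is idempotent,
    and it is nonzero because b^k absorbs it. *)
Lemma fitting_idempotent b :
  ~ nilpotent_elt b -> exists y, y * b != 0 /\ y * b * (y * b) = y * b.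
Proof.
move=> nnil.
have [P P0 Pb] : exists2 P : {poly F}, P != 0 & horner_alg b P = 0.
  pose n := (\dim {:A}).+1; pose X := [tuple b ^+ i | i < n].
  have nfree : ~ free X.
    rewrite /free size_tuple => /eqP dimX.
    by have := dimvS (subvf <<X>>); rewrite dimX ltnn.
  apply: contrapT => noP; apply: nfree; apply/freeP => k kX i.
  apply: contrapT => ki; apply: noP.
  exists (\poly_(j < n) k (inord j)).
    apply/eqP => /polyP/(_ i); rewrite coef_poly ltn_ord coef0 inord_val.
    exact: ki.
  rewrite poly_def rmorph_sum -[RHS]kX; apply: eq_bigr => j _ /=.
  rewrite (nth_mktuple _ _ j) linearZ /= rmorphXn /=.
  by rewrite mulr_algl horner_algX inord_val.
have [k [Q]] := multiplicity_XsubC P 0.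
rewrite P0 subr0 /= => Q0 defP.
pose q := horner_alg b Q.
have /factor_theorem[R defR] : root (Q - Q.[0]%:P) 0.
  by rewrite rootE !hornerE subrr.
rewrite subr0 in defR.
(* Since Q = R X + Q(0), this [W] satisfies W X + Q(0)^-1 Q = 1; multiplying by X^k and evaluating
   at [b] kills the second term. *)
pose W := - Q.[0]^-1 *: R; pose w := horner_alg b W.
have cwb : GRing.comm w b.
  by rewrite /GRing.comm -[b](horner_algX b) -!rmorphM /= mulrC.
have bk : b ^+ k = b ^+ k * (w * b).
  have /(congr1 (horner_alg b)) : 'X^k = 'X^k * (W * 'X) + Q.[0]^-1 *: P.
    rewrite defP /W; set c := Q.[0] in Q0 defR *.
    have -> : Q = R * 'X + c%:P by rewrite -defR subrK.
    rewrite -!mul_polyC polyCN !mulNr mulrN !mulrDl mulrDr !mulrA.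
    by rewrite -polyCM mulVf // mul1r (mulrC _ 'X^k) !mulrA addKr.
  rewrite rmorphD !rmorphM /= (linearZ _ P) /= Pb mulr0 addr0 rmorphXn /=.
  by rewrite !horner_algX.
have bkn n : b ^+ k = b ^+ k * (w * b) ^+ n.
  by elim: n => [|n IHn]; rewrite ?mulr1 // exprS mulrA -bk.
have wbn n : (w * b) ^+ n = w ^+ n * b ^+ n by rewrite exprMn_comm.
have ye : w ^+ k.+1 * b ^+ k * b = (w * b) ^+ k.+1.
  by rewrite wbn -mulrA -exprSr.
exists (w ^+ k.+1 * b ^+ k); rewrite ye; split.
  by apply: contra_notN nnil => /eqP e0; exists k; rewrite (bkn k.+1) e0 mulr0.
by rewrite {1}wbn (exprS b) -!mulrA -bkn -exprS wbn.
Qed.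

Definition left_ideal K : Prop := forall x a, a \in K -> x * a \in K.

Lemma left_ideal_principal a : left_ideal (fullv * <[a]>)%VS.
Proof.
move=> x _ /memv_cosetP[y _ ->]; rewrite mulrA; apply: memv_mul (memv_line _).
exact: memvf.
Qed.

(** Induction on the codimension: either [K] is already maximal among proper left ideals, or a
    strictly larger one takes its place. Competing ideals are mere predicates, so [ex_vspace] turns
    them into subspaces. *)
Lemma ex_maximal_left_ideal K : left_ideal K -> 1 \notin K ->
  exists M : {pred A}, maximal_left_ideal M /\ {subset K <= M}.
Proof.
have: (\dim {:A} - \dim K < (\dim {:A} - \dim K).+1)%N by [].
move: {2}_.+1 => n.
elim: n K => // n IHn K leKn Kid K1.
have [maxK|] := pselect (forall K', left_ideal K' -> 1 \notin K' ->
    (K <= K')%VS -> (K' <= K)%VS).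
  exists (fun x => x \in K); split=> //; split.
    split=> [|//|x a b Ka Kb]; first exact: mem0v.
    by rewrite -topredE /= in Ka Kb *; apply: memvD => //; apply: Kid.
  move=> M [M0 M1 Mid] KM.
  have [|k u v Mu Mv|K' K'M] := @ex_vspace F A [set x | x \in M]%classic => //.
    by rewrite -mulr_algl; apply: Mid.
  have/subvP K'K : (K' <= K)%VS.
    apply: maxK.
    - by move=> x a /K'M Ma; apply/K'M; rewrite /= -[_ * _]addr0; apply: Mid.
    - by apply/negP => /K'M; apply/negP.
    - by apply/subvP => a /KM Ma; apply/K'M.
  by move=> x Mx; apply: K'K; apply/K'M.
case/existsNP => K' /not_implyP[K'id] /not_implyP[K'1] /not_implyP[KK' /negP nK'K].
have [|M [maxM K'M]] := IHn K' _ K'id K'1.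
- rewrite -ltnS; apply: leq_trans leKn; rewrite ltnS; apply: ltn_sub2l.
    apply: leq_trans (dimvS (subvf K')).
    by rewrite (ltn_leqif (dimv_leqif_sup KK')).
  by rewrite (ltn_leqif (dimv_leqif_sup KK')).
by exists M; split=> // x Kx; apply: K'M; apply: (subvP KK').
Qed.

(** If some x a is not nilpotent, Fitting gives a nonzero idempotent b a. For [a] in the radical, 1
    - b a has a left inverse, as a maximal left ideal containing it would contain 1; but (1 - b a) b
    a = 0, so b a = 0. *)
Lemma jacobsonP a : jacobson A a <-> left_nil a.
Proof.
split=> [Ja x|nila M [[M0 M1 Mid] maxM]].
  apply: contrapT => /fitting_idempotent[y []].
  rewrite mulrA => /eqP e0 ee; set b := y * x in e0 ee.
  have [u ue] : exists u, u * (1 - b * a) = 1.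
    have [/memv_cosetP[u _ u1]|K1] :=
      boolP (1 \in (fullv * <[1 - b * a]>)%VS); first by exists u.
    have [M [maxM KM]] := ex_maximal_left_ideal (@left_ideal_principal _) K1.
    have [_ /negP M1 Mid] := maxM.1; case: M1.
    have -> : 1 = b * a + (1 - b * a) by rewrite addrC subrK.
    apply: Mid; first exact: (Ja M maxM).
    by apply: KM; rewrite -[X in X \in _]mul1r memv_mul ?memvf ?memv_line.
  by apply: e0; rewrite -[b * a]mul1r -ue -mulrA mulrBl mul1r ee subrr mulr0.
(* [M'] is M + A a. It is proper: 1 = m + x a would make m = 1 - x a left invertible, as x a is
   nilpotent. *)
pose M' y := `[< exists m x, m \in M /\ y = m + x * a >].
apply: contrapT => Ma; apply: Ma; apply: (maxM M').
- split.
  + by apply/asboolP; exists 0, 0; rewrite mul0r addr0.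
  + apply/negP => /asboolP[m [x [Mm m1]]]; have [u] := nilpotent_sub1_inv (nila x).
    rewrite m1 addrK -[_ * _]addr0 => um1; case/negP: M1.
    by rewrite m1 -um1; apply: Mid.
  + move=> z _ _ /asboolP[m1 [x1 [Mm1 ->]]] /asboolP[m2 [x2 [Mm2 ->]]].
    apply/asboolP; exists (z * m1 + m2), (z * x1 + x2); split; first exact: Mid.
    by rewrite mulrDr mulrDl -mulrA addrACA.
- by move=> m Mm; apply/asboolP; exists m, 0; rewrite mul0r addr0.
- by apply/asboolP; exists 0, 1; rewrite mul1r add0r.
Qed.

(** Says that A e is a minimal left ideal: each of its nonzero elements generates [e] back. *)
Definition minimal_idempotent e : Prop :=
  [/\ e != 0, e * e = e & forall x, x * e != 0 -> exists y, y * (x * e) = e].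

(** Fitting's lemma supplies a nonzero idempotent in [K]. As long as A e is not minimal, a proper
    nonzero A x e contains another one, and the dimension of A e drops. *)
Lemma ex_minimal_idempotent K : left_ideal K ->
    (forall j k, jacobson A j -> k \in K -> j * k = 0) ->
    ~ (forall k, k \in K -> jacobson A k) ->
  exists2 e, e \in K & minimal_idempotent e.
Proof.
move=> Kid JK nKJ.
have idemK k : k \in K -> ~ jacobson A k ->
    exists y, y * k != 0 /\ y * k * (y * k) = y * k.
  move=> Kk /jacobsonP/existsNP[x /fitting_idempotent[y]].
  by rewrite mulrA; exists (y * x).
have [e [Ke e0 ee]] : exists e, [/\ e \in K, e != 0 & e * e = e].
  have [k /not_implyP[Kk Jk]] := (existsNP _).2 nKJ.
  have [y [yk0 yky]] := idemK k Kk Jk.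
  by exists (y * k); split => //; apply: Kid.
have: (\dim (fullv * <[e]>) < (\dim (fullv * <[e]>)).+1)%N by [].
move: {2}_.+1 => n.
elim: n e Ke e0 ee => // n IHn e Ke e0 ee len.
have [mine|] := pselect (forall x, x * e != 0 -> exists y, y * (x * e) = e).
  by exists e.
case/existsNP => x /not_implyP[xe0 /forallNP nyx].
have [|y [ne0 nee]] := idemK _ (Kid x e Ke).
  (* If x e were in the radical, then x e = (x e) e = 0, since the radical annihilates [K]. *)
  by move=> /JK/(_ Ke)/eqP; rewrite -mulrA ee; apply/negP.
apply: (IHn (y * (x * e))) => //; first by apply/Kid/Kid.
rewrite -ltnS; apply: leq_trans len; rewrite ltnS.
have sub : (fullv * <[y * (x * e)]> <= fullv * <[e]>)%VS.
  apply/subvP => _ /memv_cosetP[z _ ->].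
  by rewrite !mulrA memv_mul ?memvf ?memv_line.
rewrite (ltn_leqif (dimv_leqif_sup sub)); apply/negP => /subvP/(_ e).
rewrite -{1}[e]mul1r memv_mul ?memvf ?memv_line => // /(_ isT)/memv_cosetP[z _].
by move=> /esym; rewrite mulrA; apply: nyx.
Qed.

Lemma central_idempotentC e x : central_idempotent e -> e * x = x * e.
Proof.
by case; rewrite memv_cap => /andP[_ /centvP->]; rewrite ?memvf.
Qed.

Lemma central_idempotentP e :
  e * e = e -> (forall x, e * x = x * e) -> central_idempotent e.
Proof.
move=> ee eC; split=> //; rewrite memv_cap memvf /=.
by apply/centvP => x _; apply: eC.
Qed.

Lemma central_idempotentM e f :
  central_idempotent e -> central_idempotent f -> central_idempotent (e * f).
Proof.
move=> Ce Cf; apply: central_idempotentP => [|x].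
  by rewrite -mulrA (mulrA f) (central_idempotentC e Cf) !mulrA Ce.2 -mulrA Cf.2.
by rewrite -mulrA (central_idempotentC _ Cf) mulrA (central_idempotentC _ Ce) mulrA.
Qed.

Lemma central_idempotent_sub1 e : central_idempotent e -> central_idempotent (1 - e).
Proof.
move=> Ce; apply: central_idempotentP => [|x].
  by rewrite mulrBl !mulrBr !mul1r mulr1 Ce.2 subrr subr0.
by rewrite mulrBl mulrBr mul1r mulr1 (central_idempotentC _ Ce).
Qed.

(** If [e] is not primitive, a proper splitting e = e1 + e2 gives a strictly smaller ideal A e1;
    induction on the dimension. *)
Lemma ex_block_below e : central_idempotent e -> e != 0 ->
  exists2 f, block_idempotent f & f * e = f.
Proof.
have: (\dim (fullv * <[e]>) < (\dim (fullv * <[e]>)).+1)%N by [].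
move: {2}_.+1 => n.
elim: n e => // n IHn e len Ce e0.
have [Be|nBe] := pselect (block_idempotent e); first by exists e => //; case: Ce.
have [e1 [e2 [Ce1 Ce2 e12 def_e [e10 e20]]]] : exists e1 e2,
    [/\ central_idempotent e1, central_idempotent e2, e1 * e2 = 0, e = e1 + e2
      & e1 != 0 /\ e2 != 0].
  apply: contrapT => no; apply: nBe; split=> // e1 e2 Ce1 Ce2 e12 def_e.
  have [->|e10] := eqVneq e1 0; [by left | right].
  have [//|e20] := eqVneq e2 0.
  by case: no; exists e1, e2.
have e1e : e1 * e = e1 by rewrite def_e mulrDr e12 addr0 Ce1.2.
have [|f Bf fe1] := IHn e1 _ Ce1 e10; last first.
  by exists f; rewrite // -fe1 -mulrA e1e.
rewrite -ltnS; apply: leq_trans len; rewrite ltnS.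
have sub : (fullv * <[e1]> <= fullv * <[e]>)%VS.
  by apply/subvP => _ /memv_cosetP[z _ ->]; rewrite -e1e mulrA memv_mul ?memvf ?memv_line.
rewrite (ltn_leqif (dimv_leqif_sup sub)); apply/negP => /subvP/(_ e2).
have e2e : e2 = e2 * e.
  by rewrite def_e mulrDr -(central_idempotentC _ Ce1) e12 add0r Ce2.2.
rewrite {1}e2e memv_mul ?memvf ?memv_line => // /(_ isT)/memv_cosetP[z _].
move/(congr1 (fun x => x * e2)); rewrite -(mulrA z) e12 mulr0 Ce2.2.
by apply/eqP.
Qed.

(** The sum [f] is a central idempotent. A block idempotent below a nonzero 1 - f would satisfy both
    e (1 - f) = e and e f = e. *)
Lemma sum_block_idempotents : \sum_(e <- block_idempotents A) e = 1.
Proof.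
set s := block_idempotents A; set f := \sum_(e <- s) e.
have Bs e : e \in s -> block_idempotent e by move/block_idempotentsP.
have Cs e : e \in s -> central_idempotent e by case/Bs.
have ef e : e \in s -> e * f = e.
  move=> es; rewrite /f (bigD1_seq e) ?block_idempotents_uniq //=.
  rewrite mulrDr (Cs e es).2 mulr_sumr big_seq_cond big1 ?addr0 // => g.
  by case/andP=> gs ge; apply: block_idempotent_orth (Bs _ _) (Bs _ _) _; rewrite // eq_sym.
have Cf : central_idempotent f.
  apply: central_idempotentP => [|x].
    by rewrite {1}/f mulr_suml big_seq [RHS]big_seq; apply: eq_bigr => e /ef.
  rewrite mulr_suml mulr_sumr big_seq [RHS]big_seq; apply: eq_bigr => e es.
  exact/central_idempotentC/Cs.
have [/eqP|f1] := eqVneq (1 - f) 0; first by rewrite subr_eq0 => /eqP.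
have [e Be] := ex_block_below (central_idempotent_sub1 Cf) f1.
have /ef es : e \in s by apply/block_idempotentsP.
rewrite mulrBr mulr1 es subrr => /esym/eqP.
by case: Be => _ /negPf->.
Qed.

End FinDimRadical.

(** * Fixed points of a permutation of p-power order in characteristic p *)

Section FixedPointSum.

Variables (F : fieldType) (p : nat) (T : finType).
Hypothesis charF : p \in [pchar F].

(** [f] is constant on the orbits of [s], and a nontrivial orbit has size divisible by p, so it
    contributes 0. *)
Lemma sum_perm_fix (s : {perm T}) k (f : T -> F) :
    (s ^+ (p ^ k) = 1)%g -> (forall x, f (s x) = f x) ->
  \sum_x f x = \sum_(x | s x == x) f x.
Proof.
move=> sk fs; have pr_p := pcharf_prime charF.
have acts : [acts <[s]>, on [set: T] | 'P]%g.
  by apply/actsP => u _ x; rewrite !inE.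
have pG : p.-group <[s]>%g.
  rewrite /pgroup [#|_|](_ : _ = #[s]%g) //; apply: pnat_dvd (_ : _ %| p ^ k)%N _.
    by rewrite order_dvdn sk.
  by rewrite pnatX pnat_id.
have forb x y : y \in orbit 'P <[s]>%g x -> f y = f x.
  case/orbitP => _ /cycleP[n ->] <-; elim: n => [|n IHn] /=; first by rewrite expg0 apermE perm1.
  by rewrite expgSr /= apermE permM fs -apermE.
rewrite [RHS]big_mkcond /=.
have toT (h : T -> F) : \sum_x h x = \sum_(x in [set: T]) h x.
  by apply: eq_bigl => x; rewrite inE.
rewrite !toT !(set_partition_big _ (orbit_partition acts)) /=.
apply: eq_bigr => _ /imsetP[x _ ->].
have [fx|nfx] := eqVneq (s x) x.
  have -> : orbit 'P <[s]>%g x = [set x].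
    by apply/orbit1P; rewrite afix_cycle; apply/afix1P; rewrite /= apermE.
  by rewrite !big_set1 fx eqxx.
rewrite [RHS]big1 => [|y /orbitP[_ /cycleP[n ->] <-]]; last first.
  rewrite ifN //; apply: contra nfx => /eqP.
  by rewrite /= /aperm -permM -expgSr expgS permM => /perm_inj->.
rewrite (eq_bigr (fun=> f x)) => [|y /forb //]; rewrite sumr_const.
have /p_natP[[|m] cm] : p.-nat #|orbit 'P <[s]>%g x|.
- by apply: pnat_dvd pG; apply: dvdn_orbit.
- have /eqP/cards1P[y oy] := cm.
  have := orbit_refl 'P <[s]>%g x; have := mem_orbit 'P x (cycle_id s).
  by rewrite oy !inE /= /aperm => /eqP sx /eqP xy; rewrite sx xy eqxx in nfx. 
- by rewrite cm expnS mulnC mulrnA -mulr_natr (pcharf0 charF) mulr0.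
Qed.

End FixedPointSum.

(** * Coefficients of products in the group algebra *)

Section GroupAlgebraElements.

Variables (F : fieldType) (gT : finGroupType).
Local Notation A := (galg F gT).
Implicit Types (a b : A) (g x y : gT).

Lemma gdelta_mulE g a x : (gdelta F g * a) x = a (g^-1 * x)%g.
Proof.
rewrite ffunE (bigD1 g) //= big1 => [|y /negPf yg]; last by rewrite ffunE yg mul0r.
by rewrite ffunE eqxx mul1r addr0.
Qed.

Lemma mul_gdeltaE g a x : (a * gdelta F g) x = a (x * g^-1)%g.
Proof.
rewrite ffunE (bigD1 (x * g^-1)%g) //= big1 => [|y nyx].
  by rewrite ffunE invMg invgK mulgKV eqxx mulr1 addr0.
rewrite ffunE; have [yx|] := eqVneq; last by rewrite mulr0.
by rewrite -yx invMg invgK mulKVg eqxx in nyx.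
Qed.

Lemma gdeltaM g h : gdelta F (g * h)%g = gdelta F g * gdelta F h.
Proof.
apply/ffunP => x; by rewrite gdelta_mulE !ffunE (can2_eq (mulKVg g) (mulKg g)).
Qed.

Lemma gdelta1 : gdelta F (1%g : gT) = 1. Proof. by []. Qed.

Lemma galg_sumE (I : Type) (r : seq I) (P : pred I) (G : I -> A) x :
  (\sum_(i <- r | P i) G i) x = \sum_(i <- r | P i) (G i x : F).
Proof.
by apply: (big_morph (fun a : A => (a x : F))) => [a b|]; rewrite ffunE.
Qed.

Lemma galg_scaleE k a x : (k *: a) x = k * a x.
Proof. by rewrite ffunE. Qed.

Lemma galg_sum_gdelta a : a = \sum_x (a x : F) *: gdelta F x.
Proof.
apply/ffunP => y; rewrite galg_sumE (bigD1 y) //= big1 => [|x nxy].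
  by rewrite galg_scaleE ffunE eqxx mulr1 addr0.
by rewrite galg_scaleE ffunE eq_sym (negPf nxy) mulr0.
Qed.

Lemma class_fun_central a b :
  (forall x g, a (x ^ g)%g = a x) -> a * b = b * a.
Proof.
move=> aJ.
rewrite (galg_sum_gdelta b) [LHS]mulr_sumr [RHS]mulr_suml; apply: eq_bigr => g _.
rewrite -scalerAl -scalerAr; congr (_ *: _); apply/ffunP => x.
rewrite gdelta_mulE mul_gdeltaE -[RHS](aJ _ g^-1%g).
by rewrite conjgE invgK mulgA mulKVg.
Qed.

Lemma gdelta_prod n (w : 'I_n -> gT) :
  gdelta F (\prod_i w i)%g = \prod_i gdelta F (w i).
Proof. by apply: big_morph => [x y|]; [apply: gdeltaM|]. Qed.

(** Distributivity writes the power as a sum over words, an index set on which rotation can act. *)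
Lemma galg_exp1E a n :
  (a ^+ n) 1%g = \sum_(w : {ffun 'I_n -> gT} | (\prod_i w i)%g == 1%g)
    \prod_i (a (w i) : F).
Proof.
rewrite {1}(galg_sum_gdelta a) -[n in LHS]card_ord -prodr_const bigA_distr_bigA /=.
rewrite galg_sumE [RHS]big_mkcond /=; apply: eq_bigr => w _.
have -> : \prod_(i < n) ((a (w i) : F) *: gdelta F (w i)) =
    (\prod_(i < n) (a (w i) : F)) *: gdelta F (\prod_i w i)%g.
  rewrite gdelta_prod; elim/big_rec3: _ => [|i x y z _ ->]; first by rewrite scale1r.
  by rewrite -scalerAl -scalerAr scalerA.
rewrite galg_scaleE ffunE eq_sym; case: ifP => _; by rewrite ?mulr1 ?mulr0.
Qed.

End GroupAlgebraElements.

(** * The sum of the p-elements *)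

Section PElementSum.

Variables (F : fieldType) (p : nat) (gT : finGroupType).
Hypothesis charF : p \in [pchar F].
Local Notation A := (galg F gT).
Implicit Types (a b : A) (g x y : gT).

(** The element c of a whole group, to be used for [N] viewed as a group of its own. *)
Definition psum : A := \sum_(x | p.-elt x) gdelta F x.

(* The words of length [p ^ k] with product [1] are permuted by rotation; only
   the constant ones survive modulo [p]. *)
Lemma galg_frobenius a k n : n.+1 = (p ^ k)%N ->
  (a ^+ n.+1) 1%g = \sum_(x | (x ^+ n.+1 == 1)%g) (a x : F) ^+ n.+1.
Proof.
move=> nk; rewrite galg_exp1E.
pose rot (w : {ffun 'I_n.+1 -> gT}) := [ffun i => w (ordS i)].
have rot_inj : injective rot.
  move=> u v /ffunP uv; apply/ffunP => i; have := uv (ord_pred i).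
  by rewrite !ffunE ord_predK.
pose s := perm rot_inj.
have sE m w (i j : 'I_n.+1) : val j = ((i + m) %% n.+1)%N -> (s ^+ m)%g w i = w j.
  elim: m w j => [|m IHm] w j jE.
    rewrite expg0 perm1; congr (w _); apply: val_inj.
    by rewrite jE addn0 modn_small.
  pose j' := Ordinal (ltn_pmod (i + m) (ltn0Sn n)).
  have -> : j = ordS j'.
    by apply: val_inj; rewrite jE /= -(addn1 (_ %% _)) modnDml addn1 addnS.
  by rewrite expgS permM (IHm _ j') // permE ffunE.
have sq : (s ^+ (p ^ k) = 1)%g.
  apply/permP => w; apply/ffunP => i; rewrite perm1 (sE _ _ _ i) // -nk.
  by rewrite modnDr modn_small.
rewrite big_mkcond (sum_perm_fix charF sq) => [|w].
  rewrite -big_mkcondr /=.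
  rewrite (reindex (fun x => [ffun=> x])) /=; last first.
    exists (fun w : {ffun 'I_n.+1 -> gT} => w ord0) => [x _|w]; first by rewrite ffunE.
    rewrite inE => /andP[/eqP sw _]; apply/ffunP => i; rewrite ffunE.
    have sm m : (s ^+ m)%g w = w.
      by elim: m => [|m IHm]; rewrite ?perm1 // expgS permM sw.
    by rewrite -{1}(sm i); apply: sE; rewrite add0n modn_small.
  apply: eq_big => [x|x _].
    have rotx : rot [ffun=> x] = [ffun=> x] by apply/ffunP => i; rewrite !ffunE.
    rewrite permE rotx eqxx.
      by rewrite (eq_bigr (fun=> x)) => [|i _]; rewrite ?ffunE // prodg_const card_ord.

  by rewrite (eq_bigr (fun=> a x)) => [|i _]; rewrite ?ffunE // prodr_const card_ord.
have sl i : s w (widen_ord (leqnSn n) i) = w (lift ord0 i).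
  rewrite permE ffunE; congr (w _); apply: val_inj; rewrite /= modn_small //.
  by rewrite ltnS.
have sm : s w ord_max = w ord0.
  by rewrite permE ffunE; congr (w _); apply: val_inj; rewrite /= modnn.
(* Rotation moves the first factor to the end; one statement serves the product of the letters and
   the product of their coefficients. *)
have rotP (R : Type) (idx : R) (op : Monoid.law idx) (h : gT -> R) :
  \big[op/idx]_i h (s w i) = op (\big[op/idx]_(i < n) h (w (lift ord0 i))) (h (w ord0)).
  by rewrite big_ord_recr /= sm; congr (op _ _); apply: eq_bigr => i _; rewrite sl.
rewrite (rotP _ _ _ id) (rotP _ _ _ (fun x => a x : F)) /= !big_ord_recl /= mulrC.
by rewrite -!eq_invg_mul eq_invg_sym eq_sym.
Qed.

(** An order p^m is at most [#|gT|], so m < p^m <= k: a crude bound that suffices. *)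
Lemma p_elt_expg k x : (#|gT| <= k)%N -> (x ^+ (p ^ k) == 1)%g = p.-elt x.
Proof.
move=> lek; have pr_p := pcharf_prime charF.
rewrite -order_dvdn; apply/idP/idP => [dv|].
  by apply: pnat_dvd dv _; rewrite pnatX pnat_id.
case/p_natP => m cx; rewrite cx dvdn_exp2l //.
apply: leq_trans (leq_trans _ lek); first exact/ltnW/(ltn_expl m (prime_gt1 pr_p)).
by rewrite -cx; apply: max_card.
Qed.

Lemma galg_exp_psum a k : (#|gT| <= k)%N ->
  (a ^+ (p ^ k)) 1%g = (\sum_(x | p.-elt x) (a x : F)) ^+ (p ^ k).
Proof.
move=> lek; have pr_p := pcharf_prime charF.
have q0 : (0 < p ^ k)%N by rewrite expn_gt0 prime_gt0.
have [n nk] : exists n, n.+1 = (p ^ k)%N by exists (p ^ k).-1; rewrite prednK.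
rewrite -nk (galg_frobenius _ nk) nk (eq_bigl _ _ (fun x => p_elt_expg x lek)).
have charq : [pchar F].-nat (p ^ k)%N.
  by rewrite (eq_pnat _ (pcharf_eq charF)) pnatX pnat_id.
apply/esym/(big_morph (fun z : F => z ^+ (p ^ k))) => [u v|].
  exact: exprDn_pchar.
by rewrite expr0n (gtn_eqF q0).
Qed.

Lemma psumE x : psum x = (p.-elt x)%:R.
Proof.
rewrite galg_sumE big_mkcond /= (bigD1 x) //= big1 => [|y nyx].
  by rewrite ffunE eqxx addr0; case: ifP.
by rewrite ffunE eq_sym (negPf nyx); case: ifP.
Qed.

Lemma psumC a : psum * a = a * psum.
Proof. by apply: class_fun_central => x g; rewrite !psumE p_eltJ. Qed.

Lemma mul_psum_coef1 a : (a * psum) 1%g = \sum_(x | p.-elt x) (a x : F).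
Proof.
rewrite ffunE [RHS]big_mkcond /=; apply: eq_bigr => x _.
by rewrite psumE mulg1 p_eltV; case: ifP; rewrite ?mulr1 ?mulr0.
Qed.

(** The coefficient of j c at g is that of g^-1 j c at 1; since g^-1 j is nilpotent, [galg_exp_psum]
    shows that a power of it vanishes. *)
Lemma jacobson_mul_psum j : jacobson A j -> j * psum = 0.
Proof.
move/jacobsonP => nilj; apply/ffunP => g; rewrite [RHS]ffunE.
have pr_p := pcharf_prime charF.
have [m jm] := nilj (gdelta F g^-1%g).
pose k := maxn #|gT| m.
have := @galg_exp_psum (gdelta F g^-1%g * j) k (leq_maxl _ _).
have lemk : (m <= p ^ k)%N.
  by apply: leq_trans (leq_maxr _ _) (ltnW (ltn_expl k (prime_gt1 pr_p))).
have z1 : (0 : A) 1%g = 0 by rewrite ffunE.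
rewrite -(subnK lemk) exprD jm mulr0 z1 => /esym/eqP.
rewrite expf_eq0 -mul_psum_coef1 -mulrA gdelta_mulE invgK mulg1.
by case/andP => _ /eqP.
Qed.

(** With l the left side and q = [p ^ #|gT|], the exponents q and q^2 give e(1) = l^q = l^(q^2),
    whence (l - e(1))^q = l^q - e(1)^q = 0. *)
Lemma idempotent_psum_coef1 e : e * e = e -> (e * psum) 1%g = e 1%g.
Proof.
move=> ee; have pr_p := pcharf_prime charF.
have eX n : e ^+ n.+1 = e by elim: n => [|n IHn]; rewrite ?expr1 // exprS IHn.
pose q := (p ^ #|gT|)%N.
have q0 : (0 < q)%N by rewrite expn_gt0 prime_gt0.
have eXq n : (0 < n)%N -> e ^+ n = e by case: n.
have e1 := @galg_exp_psum e #|gT| (leqnn _).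
have e2 := galg_exp_psum e (leq_pmulr #|gT| (isT : 0 < 2)%N).
rewrite -mul_psum_coef1 in e1 e2; set l := (e * psum) 1%g in e1 e2 *.
rewrite -/q eXq // in e1; rewrite expnM -/q eXq in e2; last by rewrite expn_gt0 q0.
have charq : [pchar F].-nat q.
  by rewrite (eq_pnat _ (pcharf_eq charF)) pnatX pnat_id.
have : (l - e 1%g) ^+ q = 0.
  rewrite exprDn_pchar // exprNn_pchar // -e1.
  by rewrite {1}e2 expnS expn1 exprM -e1 subrr.
by move/eqP; rewrite expf_eq0 subr_eq0 => /andP[_ /eqP].
Qed.

End PElementSum.

Import passmx.

(** * Minimal idempotents over a splitting field *)

Section MinimalIdempotent.

Variables (F : fieldType) (gT : finGroupType).
Local Notation A := (galg F gT).

Section CutDown.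

Variable S : {vspace A}.

(** The restriction of [f] to [S] when [f] stabilises [S]; in general [f] is followed by a
    projection onto [S]. *)
Definition cut_lfun (f : 'End(A)) : 'End(subvs_of S) :=
  (linfun (@vsproj _ _ S) \o f \o linfun (@vsval _ _ S))%VF.

Lemma cut_lfunE (f : 'End(A)) (u : subvs_of S) :
  f (vsval u) \in S -> vsval (cut_lfun f u) = f (vsval u).
Proof. by move=> Sfu; rewrite !lfunE /= lfunE /= lfunE /= lfunE /= vsprojK. Qed.

End CutDown.

Hypothesis splitF : group_splitting_field F [set: gT].

(** Schur's lemma: A e is an irreducible module, and right multiplication by e a e commutes with the
    left action, so it is a scalar; evaluate it at [e]. *)
Lemma minimal_idempotent_corner (e a : A) : minimal_idempotent e ->
  exists w : F, e * a * e = w *: e.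
Proof.
case=> e0 ee mine; pose S := (fullv * <[e]>)%VS.
pose b := vbasis {:subvs_of S}; have bb : basis_of {:subvs_of S} b := vbasisP _.
have Se x : x * e \in S by rewrite memv_mul ?memvf ?memv_line.
have ideS x v : v \in S -> x * v \in S by apply: left_ideal_principal.
have eS v : v \in S -> v * e = v.
  by case/memv_cosetP => u _ ->; rewrite -mulrA ee.
pose L x : 'End(subvs_of S) := cut_lfun S (amull x).
have LE x u : vsval (L x u) = x * vsval u.
  by rewrite cut_lfunE lfunE //=; apply/ideS/subvsP.
have LM x y : L (x * y) = (L x \o L y)%VF.
  by apply/lfunP => u; apply: subvs_inj; rewrite comp_lfunE !LE mulrA.
have L1 : L 1 = \1%VF.
  by apply/lfunP => u; apply: subvs_inj; rewrite LE id_lfunE mul1r.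
(* Matrices act on row vectors from the right, which reverses composition; the inverse restores
   multiplicativity. *)
pose rho x := mxof b b (L (gdelta F x^-1%g)).
have rhoP : mx_repr [set: gT] rho.
  split=> [|x y _ _]; rewrite /rho.
    by rewrite invg1 gdelta1 L1 mxof1 // (basis_free bb).
  by rewrite invMg gdeltaM LM (mxof_comp b b bb).
pose rG := MxRepresentation rhoP.
pose psi (v : A) := rVof b (vsproj S v).
have psiE x v : v \in S -> psi (x * v) = psi v *m mxof b b (L x).
  move=> Sv; rewrite /psi -rVof_app //; congr (rVof b _).
  by apply: subvs_inj; rewrite LE !vsprojK // ideS.
have psi_inj : {in S &, injective psi}.
  move=> u v Su Sv /(can_inj (rVofK bb))/(congr1 vsval).
  by rewrite !vsprojK.
have psi_sum x v : psi (x * v) = \sum_g (x g : F) *: psi (gdelta F g * v).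
  rewrite {1}(galg_sum_gdelta x) mulr_suml /psi !linear_sum.
    by apply: eq_bigr => g _; rewrite -scalerAl !linearZ.
have psi_surj (v : 'rV_(\dim {:subvs_of S})) : exists2 s, s \in S & v = psi s.
  exists (vsval (vecof b v)); first exact: subvsP.
  by rewrite /psi vsvalK vecofK.
have S0 : 0 \in S by apply: mem0v.
have Se1 : e \in S by rewrite -[e]mul1r.
have irrG : mx_irreducible rG.
  apply/mx_irrP; split=> [|U modU].
    case: posnP => // n0; case/eqP: e0; apply: psi_inj => //.
    by apply/rowP => i; move: (ltn_ord i); rewrite {2}n0.
  have stabU (x s : A) : (psi s <= U)%MS -> s \in S -> (psi (x * s)%R <= U)%MS.
    move=> sU Ss; rewrite psi_sum; apply: summx_sub => g _; apply: scalemx_sub.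
    rewrite psiE //; apply: submx_trans (submxMr _ sU) _.
    have /mxmoduleP/(_ g^-1%g (finset.in_setT _)) := modU.
    by rewrite /= /rho invgK.
  case/rowV0Pn => v vU v0; have [s Ss def_v] := psi_surj v.
  have [|y ye] := mine s.
    apply: contraNneq v0; rewrite eS // def_v => ->.
    by rewrite /psi !linear0.
  (* Minimality gave y s = e with s in the submodule, so every z = z e = (z y) s lies there too. *)
  rewrite -sub1mx; apply/row_subP => i; have [z Sz ->] := psi_surj (row i 1%:M).
  by rewrite -(eS z Sz) -ye (eS s Ss) mulrA; apply: stabU; rewrite -?def_v.
pose R : 'End(subvs_of S) := cut_lfun S (amulr (e * a * e)).
have RE u : vsval (R u) = vsval u * (e * a * e).
  by rewrite cut_lfunE lfunE //= mulrA; apply: Se.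
have RC x : (R \o L x = L x \o R)%VF.
  by apply/lfunP => u; apply: subvs_inj; rewrite comp_lfunE RE LE comp_lfunE LE RE mulrA.
have : centgmx rG (mxof b b R).
  apply/centgmxP => x _; rewrite /= /rho.
  by rewrite -!(mxof_comp b b bb) RC.
case/(mx_abs_irr_cent_scalar (splitF irrG))/is_scalar_mxP => w defR.
exists w; apply: psi_inj => //; first by rewrite memvZ.
have -> : psi (e * a * e) = psi e *m mxof b b R.
  rewrite /psi -rVof_app //; congr (rVof b _).
  by apply: subvs_inj; rewrite RE !vsprojK // !mulrA ee.
by rewrite defR mul_mx_scalar /psi !linearZ.
Qed.

Variable p : nat.
Hypothesis charF : p \in [pchar F].
Local Notation c := (psum F p gT).

Lemma minimal_idempotent_mul_psum e : minimal_idempotent e -> e * c = e.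
Proof.
move=> mine; have [e0 ee _] := mine.
(* The coefficient at 1 is a trace: e(g) = (g^-1 e)(1) = (e g^-1 e)(1) is a multiple of e(1). *)
have e1 : e 1%g != 0.
  apply: contra_neq e0 => e1; apply/ffunP => g; rewrite [RHS]ffunE.
  have traceC (u v : A) : (u * v) 1%g = (v * u) 1%g.
    rewrite !ffunE (reindex_inj invg_inj) /=; apply: eq_bigr => x _.
    by rewrite invgK !mulg1 mulrC.
  have [w ew] := minimal_idempotent_corner (gdelta F g^-1%g) mine.
  have : (gdelta F g^-1%g * e) 1%g = 0.
    by rewrite -ee mulrA traceC mulrA ew galg_scaleE e1 mulr0.
  by rewrite gdelta_mulE invgK mulg1.
have [w ew] := minimal_idempotent_corner c mine.
have ec : e * c = w *: e by rewrite -ew -mulrA psumC mulrA ee.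
have /eqP := idempotent_psum_coef1 charF ee.
rewrite ec galg_scaleE -subr_eq0 -[X in _ - X]mul1r -mulrBl mulf_eq0 (negPf e1) orbF.
by rewrite subr_eq0 => /eqP ->; rewrite scale1r.
Qed.

Lemma psum_cube : c ^+ 3 = c ^+ 2.
Proof.
apply/eqP; rewrite -subr_eq0; apply: contraT => /eqP nz.
have cC x : GRing.comm c x := psumC p x.
pose d := c - 1.
have dC x : GRing.comm d x.
  by apply/commr_sym/commrB; [apply/commr_sym/cC | apply: commr1].
pose z := d * c ^+ 2.
have zE : c ^+ 3 - c ^+ 2 = z by rewrite /z mulrBl mul1r -exprS.
rewrite {}zE in nz.
have [||e] := @ex_minimal_idempotent _ _ (fullv * <[z]>)%VS (@left_ideal_principal _ _ z).
- move=> j _ Jj /memv_cosetP[x _ ->].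
  have -> : x * z = c * (x * (d * c)) by rewrite /z expr2 [RHS]cC !mulrA.
  by rewrite mulrA jacobson_mul_psum // mul0r.
(* If z is in the radical then z c = d c^3 = 0, so (x d c)^3 = 0 for all x. Hence d c is in the
   radical, and z = (d c) c = 0. *)
- move=> /(_ z); rewrite -{1}[z]mul1r memv_mul ?memvf ?memv_line // => /(_ isT) Jz.
  have zc : d * c ^+ 3 = 0 by rewrite exprSr mulrA jacobson_mul_psum.
  apply: nz; rewrite /z expr2 mulrA jacobson_mul_psum //.
  apply/jacobsonP => x; exists 3%N.
  rewrite exprMn_comm; last by apply/commrM; apply/commr_sym.
  rewrite exprMn_comm // (exprSr d).
  by rewrite -(mulrA (d ^+ 2)) zc !mulr0.
(* The central factor d of z can be moved next to [e], where e d = e c - e = 0. *)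
case/memv_cosetP => x _ def_e mine; have [e0 ee _] := mine.
have ec := minimal_idempotent_mul_psum mine.
case/eqP: e0; rewrite -ee {2}def_e mulrA /z mulrA -(dC (e * x)) (mulrA d) (dC e).
by rewrite /d mulrBr ec mulr1 subrr !mul0r.
Qed.

(** Otherwise A b contains a minimal idempotent e = x b, and e = e c^2 = x c^2 b = 0. *)
Lemma jacobson_of_annihilated b :
  (forall j, jacobson A j -> j * b = 0) -> c ^+ 2 * b = 0 -> jacobson A b.
Proof.
move=> Jb ccb; apply: contrapT => nJb.
have [||e /memv_cosetP[x _ def_e] mine] :=
    @ex_minimal_idempotent _ _ (fullv * <[b]>)%VS (@left_ideal_principal _ _ b).
- move=> j _ Jj /memv_cosetP[x _ ->]; rewrite mulrA Jb //.
  apply/jacobsonP; rewrite -[j]mul1r.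
  by apply: left_nilM; apply/jacobsonP.
- by move/(_ b); rewrite -{1}[b]mul1r memv_mul ?memvf ?memv_line // => /(_ isT).
have ec := minimal_idempotent_mul_psum mine; have [/eqP[]] := mine.
rewrite -ec -ec -mulrA -expr2 def_e -mulrA (commrX 2 (commr_sym (psumC p b))).
by rewrite ccb mulr0.
Qed.

End MinimalIdempotent.

(** * Passage from F[N] to F[G] for a normal subgroup *)

Section NormalSubgroup.

Variables (F : fieldType) (gT : finGroupType) (N : {group gT}).
Local Notation A := (galg F gT).
Local Notation B := (galg F (subg_of N)).
Local Notation incl := (galg_incl (F := F) (N := N)).
Implicit Types (a j : B) (b : A) (g : gT).

Lemma galg_inclE a x : incl a x = if x \in N then (a (subg N x) : F) else 0.
Proof.
rewrite galg_sumE; case: ifP => [Nx|N'x].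
  rewrite (bigD1 (subg N x)) //= big1 => [|y nyx].
    by rewrite galg_scaleE ffunE subgK // eqxx mulr1 addr0.
  rewrite galg_scaleE ffunE; case: eqP => [xy|_]; last by rewrite mulr0.
  by rewrite xy sgvalK eqxx in nyx.
rewrite big1 // => y _; rewrite galg_scaleE ffunE; case: eqP => [xy|_].
  by rewrite xy subgP in N'x.
by rewrite mulr0.
Qed.

Lemma galg_incl_sgval a (n : subg_of N) : incl a (sgval n) = a n.
Proof. by rewrite galg_inclE subgP sgvalK. Qed.

Lemma galg_incl_inj : injective incl.
Proof.
move=> a1 a2 a12; apply/ffunP => n.
by rewrite -!galg_incl_sgval a12.
Qed.

Lemma galg_incl_mulE a b x :
  (incl a * b) x = \sum_(m : subg_of N) (a m : F) * b ((sgval m)^-1 * x)%g.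
Proof.
rewrite mulr_suml galg_sumE; apply: eq_bigr => m _.
by rewrite -scalerAl galg_scaleE gdelta_mulE.
Qed.

Lemma galg_inclM a1 a2 : incl (a1 * a2) = incl a1 * incl a2.
Proof.
apply/ffunP => x; rewrite galg_incl_mulE galg_inclE; case: ifP => [Nx|N'x].
  rewrite ffunE; apply: eq_bigr => m _.
  rewrite galg_inclE groupM ?groupV ?subgP //; congr (_ * a2 _).
  by apply: val_inj; rewrite /= !subgK ?groupM ?groupV ?subgP.
rewrite big1 // => m _; rewrite galg_inclE groupMl ?groupV ?subgP // N'x.
by rewrite mulr0.
Qed.

(** The part of [b] on the coset N g, translated into F[N]; being F[N]-linear in [b], it inherits
    annihilation by J and by c^2. *)
Definition coset_comp g b : B := [ffun n => b (sgval n * g)%g].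

Lemma coset_comp_incl_mul g a b :
  coset_comp g (incl a * b) = a * coset_comp g b.
Proof.
apply/ffunP => n; rewrite [LHS]ffunE galg_incl_mulE [RHS]ffunE.
by apply: eq_bigr => m _; rewrite ffunE /= mulgA.
Qed.

Lemma coset_decomposition b : exists T : {set gT},
  b = \sum_(t in T) incl (coset_comp t b) * gdelta F t.
Proof.
exists [set repr (N :* x) | x : gT]; apply/ffunP => x; rewrite galg_sumE.
have termE t : (incl (coset_comp t b) * gdelta F t) x = if x \in N :* t then b x else 0.
  rewrite mul_gdeltaE galg_inclE mem_rcoset; case: ifP => // Nxt.
  by rewrite ffunE subgK // mulgKV.
rewrite (eq_bigr _ (fun t _ => termE t)) (bigD1 (repr (N :* x))) /=; last first.
  by apply: imset_f.
rewrite (rcoset_eqP (mem_repr_rcoset N x)) rcoset_refl big1 ?addr0 //.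
move=> t /andP[/imsetP[y _ def_t] ntx]; case: ifP => // /rcoset_eqP xt.
case/eqP: ntx; rewrite {1}def_t; congr repr.
by rewrite xt def_t; apply/esym/rcoset_eqP/mem_repr_rcoset.
Qed.

(** For [N] normal this is g^-1 a g, computed inside F[N]. *)
Definition galg_conj g a : B := [ffun n => a (subg N (sgval n ^ g^-1))%g].

Hypothesis nNG : N <| [set: gT].

Lemma memNJ x g : (x ^ g \in N)%g = (x \in N).
Proof. by apply/memJ_norm/(fintype.subsetP (normal_norm nNG)); rewrite inE. Qed.

Lemma galg_incl_conj g a : incl a * gdelta F g = gdelta F g * incl (galg_conj g a).
Proof.
apply/ffunP => x; rewrite mul_gdeltaE gdelta_mulE !galg_inclE.
have xJ : (x * g^-1 = (g^-1 * x) ^ g^-1)%g by rewrite conjgE invgK mulgA mulKVg.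
rewrite xJ memNJ; case: ifP => // Nx.
by rewrite ffunE subgK.
Qed.

Lemma galg_conjK g : cancel (galg_conj g^-1%g) (galg_conj g).
Proof.
move=> a; apply/ffunP => n; rewrite !ffunE subgK ?memNJ ?subgP //.
by rewrite invgK conjgKV sgvalK.
Qed.

Lemma galg_conjM g a1 a2 : galg_conj g (a1 * a2) = galg_conj g a1 * galg_conj g a2.
Proof.
have dK : cancel ( *%R (gdelta F g)) ( *%R (gdelta F g^-1%g)).
  by move=> b; rewrite mulrA -gdeltaM mulVg mul1r.
apply/galg_incl_inj/(can_inj dK).
rewrite -galg_incl_conj !galg_inclM [RHS]mulrA -galg_incl_conj -!mulrA.
by rewrite -galg_incl_conj.
Qed.

Lemma jacobson_conj g j : jacobson B j -> jacobson B (galg_conj g j).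
Proof.
move/jacobsonP => nilj; apply/jacobsonP => x.
have [n jn] := nilj (galg_conj g^-1%g x); exists n.+1.
rewrite -[x](galg_conjK g) -galg_conjM.
have conjX y m : galg_conj g y ^+ m.+1 = galg_conj g (y ^+ m.+1).
  by elim: m => // m IHm; rewrite exprS IHm -galg_conjM -exprS.
rewrite conjX exprS jn mulr0; apply/ffunP => y.
by rewrite !ffunE.
Qed.

Local Notation J := (incl @` jacobson B)%classic.

Lemma mem_annihilator_jacobson b :
  b \in right_annihilator J <-> forall j, jacobson B j -> incl j * b = 0.
Proof.
split=> [/right_annihilatorP Jb j Jj|Jb]; first by apply: Jb; exists j.
by apply/right_annihilatorP => _ [j Jj <-]; apply: Jb.
Qed.

(** By linearity x may be a group element g, and j g b = g (g^-1 j g) b = 0 because conjugation by g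
    preserves J. *)
Lemma annihilator_jacobson_mull (x : A) b :
  b \in right_annihilator J -> x * b \in right_annihilator J.
Proof.
move/mem_annihilator_jacobson => Jb; rewrite (galg_sum_gdelta x) mulr_suml.
apply: memv_suml => g _; rewrite -scalerAl memvZ //.
apply/mem_annihilator_jacobson => j Jj.
by rewrite mulrA galg_incl_conj -mulrA Jb ?mulr0 //; apply: jacobson_conj.
Qed.

Lemma annihilator_jacobson_mulr b (x : A) :
  b \in right_annihilator J -> b * x \in right_annihilator J.
Proof.
move/mem_annihilator_jacobson => Jb; apply/mem_annihilator_jacobson => j Jj.
by rewrite mulrA Jb ?mul0r.
Qed.

(** A representation of the group type [subg_of N] is pulled back to [N] along [subg], which
    preserves irreducibility and absolute irreducibility. *)
Lemma splitting_field_subg : group_splitting_field F N ->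
  group_splitting_field F [set: subg_of N].
Proof.
move=> splitN n rG irrG.
have preN : (subg N @*^-1 [set: subg_of N])%G == N :> {set gT}.
  by rewrite /= finset.eqEsubset finset.subsetIl; apply/fintype.subsetP => x Nx; rewrite !inE Nx.
have imN : [set: subg_of N] \subset (subg N @* N)%g by rewrite im_subg.
have := splitN _ (eqg_repr (morphpre_repr [morphism of subg N] rG) preN).
by rewrite eqg_mx_abs_irr (morphpre_mx_abs_irr _ imN) eqg_mx_irr (morphpre_mx_irr _ imN); apply.
Qed.

Variable p : nat.
Hypothesis charF : p \in [pchar F].
Local Notation c := (\sum_(x in N | p.-elt x) gdelta F x : A).

Lemma galg_incl_psum : incl (psum F p (subg_of N)) = c.
Proof.
apply/ffunP => x; rewrite galg_inclE [RHS]galg_sumE; case: ifP => [Nx|N'x].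
  rewrite psumE (_ : p.-elt (subg N x) = p.-elt x); last first.
    by rewrite /p_elt -(order_injm (injm_sgval N) (finset.in_setT _)) /= subgK.
  case: (boolP (p.-elt x)) => px.
    rewrite (bigD1 x) ?Nx //= ffunE eqxx big1 ?addr0 // => y /andP[_ nyx].
    by rewrite ffunE eq_sym (negPf nyx).
  rewrite big1 // => y /andP[_ py]; rewrite ffunE; case: eqP => // xy.
  by rewrite xy py in px.
rewrite big1 // => y /andP[Ny _]; rewrite ffunE; case: eqP => // xy.
by rewrite xy Ny in N'x.
Qed.

Lemma psum_normal_central b : c * b = b * c.
Proof.
apply: class_fun_central => x g; rewrite -galg_incl_psum !galg_inclE memNJ.
case: ifP => // Nx; rewrite !psumE; congr (_%:R : F).
rewrite /p_elt -!(order_injm (injm_sgval N) (finset.in_setT _)) /=.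
by rewrite !subgK ?memNJ // orderJ.
Qed.

Lemma psum_sqr_annihilator : c ^+ 2 \in right_annihilator J.
Proof.
apply/mem_annihilator_jacobson => j Jj.
rewrite expr2 -galg_incl_psum -!galg_inclM mulrA (jacobson_mul_psum charF Jj) mul0r.
by apply/ffunP => x; rewrite galg_inclE !ffunE if_same.
Qed.

Hypothesis splitN : group_splitting_field F N.

Lemma psum_sqr_idempotent : c ^+ 2 * c ^+ 2 = c ^+ 2.
Proof.
have c3 : c ^+ 3 = c ^+ 2.
  have := psum_cube (splitting_field_subg splitN) charF.
  move/(congr1 incl); rewrite !exprS expr0 !mulr1 !galg_inclM galg_incl_psum.
  by [].
by rewrite -exprD (exprS _ 3) c3 -exprS c3.
Qed.

(** Every coset component of [b] lies in J by [jacobson_of_annihilated], and J kills t b', which is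
    again in the annihilator. *)
Lemma annihilated_mul_eq0 b b' :
    b \in right_annihilator J -> c ^+ 2 * b = 0 ->
    b' \in right_annihilator J ->
  b * b' = 0.
Proof.
move=> /mem_annihilator_jacobson Jb ccb Jb'.
have [T ->] := coset_decomposition b; rewrite mulr_suml big1 // => t _.
have /mem_annihilator_jacobson Jtb' := annihilator_jacobson_mull (gdelta F t) Jb'.
rewrite -mulrA; apply: Jtb'.
apply: (jacobson_of_annihilated (splitting_field_subg splitN) charF) => [j Jj|].
  rewrite -coset_comp_incl_mul Jb //; apply/ffunP => n; by rewrite !ffunE.
rewrite -coset_comp_incl_mul expr2 galg_inclM galg_incl_psum -expr2 ccb.
by apply/ffunP => n; rewrite !ffunE.
Qed.

(** Each x b satisfies the same two conditions as [b], so its square is zero. *)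
Lemma annihilated_jacobson b :
  b \in right_annihilator J -> c ^+ 2 * b = 0 -> jacobson A b.
Proof.
move=> Ib ccb; apply/jacobsonP => x; exists 2%N; rewrite expr2.
have Ixb := annihilator_jacobson_mull x Ib.
apply: annihilated_mul_eq0 => //.
by rewrite mulrA -(commrX 2 (commr_sym (psum_normal_central x))) -mulrA ccb mulr0.
Qed.

(** The difference e (1 - c^2) is idempotent, while [annihilated_mul_eq0] makes its square zero. *)
Lemma central_idempotent_annihilated e : central_idempotent e ->
  e \in right_annihilator J -> e * c ^+ 2 = e.
Proof.
move=> Ce Ie; apply/esym/eqP; rewrite -subr_eq0; apply/eqP.
have Cc : central_idempotent (c ^+ 2).
  apply: central_idempotentP => [|x]; first exact: psum_sqr_idempotent.
  exact/commr_sym/commrX/commr_sym/psum_normal_central.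
have -> : e - e * c ^+ 2 = e * (1 - c ^+ 2) by rewrite mulrBr mulr1.
have Ce' := central_idempotentM Ce (central_idempotent_sub1 Cc).
rewrite -Ce'.2; have Ie' := annihilator_jacobson_mulr (1 - c ^+ 2) Ie.
apply: annihilated_mul_eq0 => //.
rewrite mulrA (central_idempotentC _ Cc) -mulrA mulrBr mulr1.
by rewrite psum_sqr_idempotent subrr mulr0.
Qed.

(** Primitivity applied to e = e c^2 + e (1 - c^2): were the second term 0, e = e c^2 would
    annihilate J. *)
Lemma block_idempotent_annihilated e : block_idempotent e ->
  e \notin right_annihilator J -> e * c ^+ 2 = 0.
Proof.
move=> [Ce _ prime_e] nIe.
have Cc : central_idempotent (c ^+ 2).
  apply: central_idempotentP => [|x]; first exact: psum_sqr_idempotent.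
  exact/commr_sym/commrX/commr_sym/psum_normal_central.
have Cc' := central_idempotent_sub1 Cc.
have [||//|ec'] := prime_e _ _ (central_idempotentM Ce Cc) (central_idempotentM Ce Cc').
- rewrite mulrA -(mulrA e) (central_idempotentC e Cc) mulrA Ce.2 -mulrA.
  by rewrite mulrBr mulr1 Cc.2 subrr mulr0.
- by rewrite -mulrDr addrC subrK mulr1.
- case/negP: nIe; have <- : e * c ^+ 2 = e.
    by apply/esym/eqP; rewrite -subr_eq0 -[X in X - _]mulr1 -mulrBr ec'.
  exact: annihilator_jacobson_mull psum_sqr_annihilator.
Qed.

End NormalSubgroup.

(** * The block decomposition of the annihilator *)

Lemma directv_filter_seq (F : fieldType) (V : vectType F) (I : eqType) (x0 : I)
    (r : seq I) (P : pred I) (U : {vspace V}) (W : I -> {vspace V}) :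
  directv (U + \sum_(i < size r | P (nth x0 r i)) W (nth x0 r i)) ->
  directv (U + \sum_(i <- r | P i) W i).
Proof. by rewrite !directvE /= !(big_nth x0) !big_mkord. Qed.

Theorem corollary4p3 (F : fieldType) (p : nat) (gT : finGroupType)
    (N : {group gT}) :
  p \in [pchar F] ->
  N <| [set: gT] ->
  group_splitting_field F [set: gT] ->
  group_splitting_field F N ->
  let J := (galg_incl (N := N) @` jacobson (galg F (subg_of N)))%classic in
  let I := right_annihilator J in
  let c : galg F gT := \sum_(x in N | p.-elt x) gdelta F x in
  [/\ I = (fullv * <[c ^+ 2]>
           + \sum_(e <- block_idempotents (galg F gT) | e \notin I)
                I * <[e]>)%VS,
      directv (fullv * <[c ^+ 2]>
           + \sum_(e <- block_idempotents (galg F gT) | e \notin I)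
                I * <[e]>)
    & ([set` I] `<=` jacobson (galg F gT))%classic <-> c ^+ 2 = 0].
Proof.
move=> charF nNG _ splitN J I c.
have c2I : c ^+ 2 \in I := psum_sqr_annihilator N charF.
have c2c2 : c ^+ 2 * c ^+ 2 = c ^+ 2 := psum_sqr_idempotent charF splitN.
have c2C x : c ^+ 2 * x = x * c ^+ 2.
  exact/commr_sym/commrX/commr_sym/psum_normal_central.
pose r := block_idempotents (galg F gT).
have Br e : e \in r -> block_idempotent e by move/block_idempotentsP.
have Cr e : e \in r -> central_idempotent e by case/Br.
have eI e : e \in r -> e \in I -> e * c ^+ 2 = e.
  by move=> /Cr Ce; apply: central_idempotent_annihilated.
have enI e : e \in r -> e \notin I -> e * c ^+ 2 = 0.
  by move=> /Br Be; apply: block_idempotent_annihilated.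
have eI_mul e u : e \in r -> u \in (I * <[e]>)%VS -> u * e = u.
  by move=> er /memv_cosetP[v _ ->]; rewrite -mulrA (Cr e er).2.
split.
- apply/eqP; rewrite eqEsubv; apply/andP; split; apply/subvP => b.
    (* Split b as the sum of the b e: for e in I, b e = b e c^2 lies in F[G] c^2; the other terms
       lie in I e. *)
    move=> Ib; rewrite -[b]mulr1 -(sum_block_idempotents (galg F gT)) mulr_sumr.
    rewrite (bigID (fun e => e \in I)) /=; apply: memv_add.
      rewrite big_seq_cond; apply: memv_suml => e /andP[er Ie].
      by rewrite -(eI e er Ie) mulrA memv_mul ?memvf ?memv_line.
    apply: (big_ind2 (fun u (U : {vspace galg F gT}) => u \in U)) => [|u U v V|e _].
    + exact: mem0v.
    + exact: memv_add.
    + by rewrite memv_mul ?memv_line.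
  case/memv_addP => _ /memv_cosetP[x _ ->] [u us ->].
  apply: memvD; first exact: annihilator_jacobson_mull.
  apply: (subvP _ _ us); rewrite big_seq_cond.
  elim/big_ind: _ => [|U V UI VI|e _]; first exact: sub0v.
    by rewrite subv_add UI VI.
  apply/subvP => _ /memv_cosetP[v Iv ->]; exact: annihilator_jacobson_mulr.
(* Indexing the summands by positions in [r] gives a finite index type; distinct positions carry
   orthogonal idempotents. *)
- apply: (directv_filter_seq (x0 := 0)); rewrite directv_addE /=.
  have tr (i : 'I_(size r)) : nth 0 r i \in r by rewrite mem_nth.
  apply/and3P; split.
  + by rewrite directv_trivial.
  + apply/directv_sum_independent => us usI us0 i Ii.
    rewrite -(eI_mul _ _ (tr i) (usI i Ii)).
    have := congr1 (fun u => u * nth 0 r i) us0; rewrite /= mul0r mulr_suml.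
    rewrite (bigD1 i) //= big1 ?addr0 // => j /andP[Ij nji].
    rewrite -(eI_mul _ _ (tr j) (usI j Ij)) -mulrA.
    rewrite (block_idempotent_orth (Br _ (tr j)) (Br _ (tr i))) ?mulr0 //.
    by rewrite nth_uniq ?block_idempotents_uniq.
  (* Right multiplication by c^2 fixes the first summand and kills every I e with e outside I. *)
  + apply/eqP/vspaceP => u; rewrite memv0 memv_cap; apply/idP/eqP => [|->]; last by rewrite !mem0v.
    case/andP => /memv_cosetP[x _ def_u] /memv_sumP[us usI us_u].
    have -> : u = u * c ^+ 2 by rewrite def_u -mulrA c2c2.
    rewrite us_u mulr_suml big1 // => i Ii.
    by rewrite -(eI_mul _ _ (tr i) (usI i Ii)) -mulrA enI ?mulr0.
- split=> [IJ|c20 b /= Ib].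
    (* c^2 is then both nilpotent and idempotent. *)
    have /jacobsonP/(_ 1)[n] := IJ _ c2I; rewrite mul1r => c2n.
    have c2X m : (c ^+ 2) ^+ m.+1 = c ^+ 2.
      by elim: m => // m IHm; rewrite exprS IHm c2c2.
    by rewrite -(c2X n) exprS c2n mulr0.
  apply: (annihilated_jacobson nNG charF splitN) => //.
  by rewrite -/c c20 mul0r.
Qed.
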